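(* Let $n\geq 15$ with $n\equiv 3\pmod 4$ and $r=4$. Let $V=\{x_1,\dots,x_{n-7}\}\sqcup\{y_1,\dots,y_7\}$ and consider the labelled graph on $V$ with edges: for $1\leq s\leq n-13$, $\{x_s,x_{s+1}\}$ with label $0$ if $s$ is odd and $1$ if $s$ is even; $\{x_{n-12},x_{n-11}\}$ with the two labels $0$ and $2$; $\{x_{n-11},x_{n-10}\}$ with label $1$; $\{x_{n-10},x_{n-9}\}$ with label $2$; $\{x_{n-9},x_{n-8}\}$ with label $1$; $\{x_{n-8},x_{n-7}\}$ with label $2$; $\{y_s,y_{s+1}\}$ for $1\leq s\leq 6$ with label $2$ if $s$ is odd and $1$ if $s$ is even; and $\{x_{n-9},y_2\}$, $\{x_{n-8},y_3\}$ with label $3$. Then $G\cong A_n$ and $(G,(\rho_0,\rho_1,\rho_2,\rho_3))$ is a string C-group of rank 4, with Schläfli type $\{10,7,4\}$ if $n=15$ and $\{2(n-10),14,4\}$ if $n>15$.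
   Context: A string group generated by involutions (sggi) of rank $r$ is a pair $(G,(\rho_0,\dots,\rho_{r-1}))$ where $\rho_0,\dots,\rho_{r-1}$ are involutions generating the group $G$ such that $(\rho_i\rho_j)^2=1$ whenever $|i-j|\geq 2$. It is a string C-group if in addition it satisfies the intersection property: for all $J,K\subseteq\{0,\dots,r-1\}$, $\langle \rho_j : j\in J\rangle\cap\langle\rho_k : k\in K\rangle=\langle \rho_j : j\in J\cap K\rangle$. The Schläfli type is $\{p_1,\dots,p_{r-1}\}$ where $p_i$ is the order of $\rho_{i-1}\rho_i$. Labelled-graph convention: the vertex set $V$ is finite, and each edge $\{a,b\}$ ($a\neq b$) carries one or more labels from $\{0,\dots,r-1\}$, the edges carrying any given label being pairwise disjoint; $\rho_k$ denotes the permutation of $V$ equal to the product of the transpositions $(a\,b)$ over all edges $\{a,b\}$ carrying label $k$, and $G=\langle\rho_0,\dots,\rho_{r-1}\rangle\leq \mathrm{Sym}(V)$. *)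

(* Defs.v *)
From HB Require Import structures.
From mathcomp Require Import all_boot all_fingroup all_solvable.
Set Implicit Arguments. Unset Strict Implicit. Unset Printing Implicit Defensive.
Local Open Scope group_scope.

Definition is_sggi (gT : finGroupType) (r : nat) (rho : 'I_r -> gT) : bool :=
  [forall i : 'I_r, #[rho i] == 2%N] &&
  [forall i : 'I_r, forall j : 'I_r, ((i + 2 <= j)%N || (j + 2 <= i)%N) ==> ((rho i * rho j) ^+ 2 == 1)].

Definition intersection_property (gT : finGroupType) (r : nat) (rho : 'I_r -> gT) : Prop :=
  forall J K : {set 'I_r}, <<rho @: J>> :&: <<rho @: K>> = <<rho @: (J :&: K)>>.

Definition string_C_group (gT : finGroupType) (r : nat) (rho : 'I_r -> gT) : Prop :=
  is_sggi rho /\ intersection_property rho.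

(* Vertex set V = 'I_n : x_s is encoded as s-1 (1 <= s <= n-7),
   y_s is encoded as n-8+s (1 <= s <= 7). *)
Definition vx (s : nat) : nat := s.-1.
Definition vy (n s : nat) : nat := (n - 8 + s)%N.

Definition graph_edges (n : nat) : seq (nat * nat * seq nat) :=
  [seq (vx s, vx s.+1, [:: if odd s then 0%N else 1%N]) | s <- iota 1 (n - 13)] ++
  [:: (vx (n - 12), vx (n - 11), [:: 0%N; 2%N]);
      (vx (n - 11), vx (n - 10), [:: 1%N]);
      (vx (n - 10), vx (n - 9),  [:: 2%N]);
      (vx (n - 9),  vx (n - 8),  [:: 1%N]);
      (vx (n - 8),  vx (n - 7),  [:: 2%N])] ++
  [seq (vy n s, vy n s.+1, [:: if odd s then 2%N else 1%N]) | s <- iota 1 6] ++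
  [:: (vx (n - 9), vy n 2, [:: 3%N]);
      (vx (n - 8), vy n 3, [:: 3%N])].

(* the transposition (a b) on 'I_n (identity if an endpoint is out of range,
   which never happens for n >= 15) *)
Definition transp (n a b : nat) : {perm 'I_n} :=
  match insub a, insub b with
  | Some a', Some b' => tperm a' b'
  | _, _ => 1
  end.

Definition rho (n k : nat) : {perm 'I_n} :=
  \prod_(e <- graph_edges n | k \in e.2) transp n e.1.1 e.1.2.

Definition rho4 (n : nat) (i : 'I_4) : {perm 'I_n} := rho n i.

Definition Ggraph (n : nat) : {group {perm 'I_n}} := <<[set rho4 n i | i : 'I_4]>>%G.

(* Main.v *)
Require Import Defs.
From mathcomp Require Import all_boot all_fingroup all_solvable zify.
Set Implicit Arguments. Unset Strict Implicit. Unset Printing Implicit Defensive.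

(** Pair x_(n-6-s) with y_s for 1 <= s <= 7. The group <rho_1, rho_2, rho_3> preserves these seven pairs and
    moves the remaining vertices only through rho_1, so words in these generators are evaluated by a computation
    on fourteen points that does not depend on n.

    G = A_n: some word in rho_1, rho_2, rho_3 swaps x_(n-13) with y_7, and its quotient by its rho_0-conjugate
    is the 3-cycle on x_(n-14), x_(n-13), y_7. Conjugates of it give all the 3-cycles on y_7, y_6 and a third
    vertex, the third vertex running down the path by conjugation by rho_0 and rho_1.

    Intersection property: it reduces to <i, T> /\ <j, T> <= <T> for distinct i, j outside T. As generators
    with non-adjacent indices commute, this amounts to rank 2 cases, where fixed points, the seven pairs and
    the invariance of {y_1, .., y_7} decide, and to
    <rho_1, rho_2, rho_3> /\ <rho_0, rho_1, rho_2> = <rho_1, rho_2>. *)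

(** These are the degrees n of the theorem; the explicit successor lets [inord] build elements of
    ['I_(deg k)]. *)
Local Notation deg k := (4 * k + 14).+1.
Local Notation span k J := <<rho4 (deg k) @: J>>%g.
Local Notation rot01 k := (rho (deg k) 0 * rho (deg k) 1)%g.

(** * The generators as functions on vertex numbers *)

(** [inord] sends a number out of range to 0, whence the bounds [i < deg k] below. *)
Definition ap k (g : {perm 'I_(deg k)}) (i : nat) : nat := g (inord i).

Lemma ap_lt k (g : {perm 'I_(deg k)}) i : ap g i < deg k.
Proof. exact: ltn_ord. Qed.

Lemma apM k (g h : {perm 'I_(deg k)}) i : ap (g * h)%g i = ap h (ap g i).
Proof. by rewrite /ap permM inord_val. Qed.

Lemma ap1 k i : i < deg k -> ap (1%g : {perm 'I_(deg k)}) i = i.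
Proof. by move=> lt_i; rewrite /ap perm1 inordK. Qed.

Lemma eq_ap k (g h : {perm 'I_(deg k)}) :
  (forall i, i < deg k -> ap g i = ap h i) -> g = h.
Proof.
move=> eq_gh; apply/permP => x; apply/val_inj.
by have := eq_gh x (ltn_ord x); rewrite /ap inord_val.
Qed.

Lemma ap_inj k (g : {perm 'I_(deg k)}) i j :
  i < deg k -> j < deg k -> ap g i = ap g j -> i = j.
Proof.
move=> lt_i lt_j /val_inj/perm_inj eq_ij.
by rewrite -(inordK lt_i) eq_ij inordK.
Qed.

Definition swapn (a b i : nat) := if i == a then b else if i == b then a else i.

Lemma swapn_lt n a b i : a < n -> b < n -> i < n -> swapn a b i < n.
Proof. by rewrite /swapn; case: ifP => // _; case: ifP. Qed.

Lemma ap_tperm k a b i : a < deg k -> b < deg k -> i < deg k ->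
  ap (tperm (inord a) (inord b) : {perm 'I_(deg k)}) i = swapn a b i.
Proof.
move=> lt_a lt_b lt_i; rewrite /ap permE /= /swapn -!val_eqE /= !inordK //.
by case: ifP => _; [|case: ifP => _]; rewrite inordK.
Qed.

Lemma transpE k a b : a < deg k -> b < deg k ->
  transp (deg k) a b = tperm (inord a) (inord b).
Proof.
move=> lt_a lt_b; rewrite /transp !insubT /=.
by congr (tperm _ _); apply/val_inj; rewrite /= inordK.
Qed.

(** A product of permutations applies its left factor first, so the transpositions act in list
    order. *)
Definition walk j (s : seq (nat * nat * seq nat)) i :=
  foldl (fun i e => if j \in e.2 then swapn e.1.1 e.1.2 i else i) i s.

Lemma walk_cat j s1 s2 i : walk j (s1 ++ s2) i = walk j s2 (walk j s1 i).
Proof. exact: foldl_cat. Qed.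

Lemma ap_prod_transp k j s i :
    all (fun e : nat * nat * seq nat => (e.1.1 < deg k) && (e.1.2 < deg k)) s -> i < deg k ->
  ap (\prod_(e <- s | j \in e.2) transp (deg k) e.1.1 e.1.2)%g i = walk j s i.
Proof.
elim: s i => [|e s IHs] i /=; first by rewrite big_nil => _ /ap1.
case/andP=> /andP[lt1 lt2] lts lt_i; rewrite big_cons /walk /= -/(walk _ _ _).
case: ifP => _; last exact: IHs.
by rewrite apM transpE // ap_tperm // IHs // swapn_lt.
Qed.

Definition chain N : seq (nat * nat * seq nat) :=
  [seq (vx s, vx s.+1, [:: if odd s then 0 else 1]) | s <- iota 1 N].

Lemma chain_step K : chain K.+1.*2 = chain K.*2 ++
  [:: (K.*2, K.*2.+1, [:: 0]); (K.*2.+1, K.*2.+2, [:: 1])].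
Proof.
rewrite /chain doubleS -{1}addn2 iotaD map_cat /=; congr (_ ++ _).
by rewrite /vx /= !add0n !add1n odd_double.
Qed.

(** Edges with a common label are disjoint, so each vertex moves at most once; the induction adds
    one edge of each label. *)
Lemma walk_chain j K i : walk j (chain K.*2) i =
  if (j == 0) && (i < K.*2) || (j == 1) && (0 < i <= K.*2) then
    (if odd i == (j == 0) then i.-1 else i.+1)
  else i.
Proof.
elim: K => [|K IHK]; first by rewrite /walk /=; case: ifP; lia.
rewrite chain_step walk_cat IHK /walk /= !inE /swapn.
case: j {IHK} => [|[|j]] //=; repeat case: ifP; lia.
Qed.

Definition tail_edges n : seq (nat * nat * seq nat) :=
  [:: (vx (n - 12), vx (n - 11), [:: 0%N; 2%N]);
      (vx (n - 11), vx (n - 10), [:: 1%N]);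
      (vx (n - 10), vx (n - 9),  [:: 2%N]);
      (vx (n - 9),  vx (n - 8),  [:: 1%N]);
      (vx (n - 8),  vx (n - 7),  [:: 2%N])] ++
  [seq (vy n s, vy n s.+1, [:: if odd s then 2%N else 1%N]) | s <- iota 1 6] ++
  [:: (vx (n - 9), vy n 2, [:: 3%N]);
      (vx (n - 8), vy n 3, [:: 3%N])].

Lemma graph_edges_deg k :
  graph_edges (deg k) = chain (2 * k + 1).*2 ++ tail_edges (deg k).
Proof. by rewrite /graph_edges -/(chain _); congr (chain _ ++ _); lia. Qed.

Definition tail14 : seq (nat * nat * seq nat) :=
  [:: (1, 2, [:: 0; 2]); (2, 3, [:: 1]); (3, 4, [:: 2]); (4, 5, [:: 1]); (5, 6, [:: 2]);
      (7, 8, [:: 2]); (8, 9, [:: 1]); (9, 10, [:: 2]); (10, 11, [:: 1]); (11, 12, [:: 2]);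
      (12, 13, [:: 1]); (4, 8, [:: 3]); (5, 9, [:: 3])].

Definition shift m (s : seq (nat * nat * seq nat)) :=
  [seq (m + e.1.1, m + e.1.2, e.2) | e <- s].

Lemma tail_edgesE k : tail_edges (deg k) = shift (4 * k + 1) tail14.
Proof.
rewrite /tail_edges /vx /vy /=.
repeat (congr (_ :: _)); congr (_, _, _); lia.
Qed.

Lemma walk_shift j m s i : walk j (shift m s) (m + i) = m + walk j s i.
Proof.
rewrite /walk; elim: s i => //= e s IHs i; case: ifP => // _; rewrite -IHs.
by congr foldl; rewrite /swapn !eqn_add2l; case: ifP => // _; case: ifP.
Qed.

Lemma walk_shift_lt j m s i : i < m -> walk j (shift m s) i = i.
Proof.
move=> lt_i; rewrite /walk; elim: s => //= e s; rewrite /swapn.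
by rewrite !ltn_eqF ?ltn_addr // if_same.
Qed.

Lemma all_chain n N : N < n -> 
  all (fun e : nat * nat * seq nat => (e.1.1 < n) && (e.1.2 < n)) (chain N).
Proof.
move=> lt_N; apply/allP => e /mapP[s]; rewrite mem_iota => Hs -> /=; rewrite /vx; lia.
Qed.

Lemma ap_rho_walk k j i : i < deg k ->
  ap (rho (deg k) j) i = walk j (shift (4 * k + 1) tail14) (walk j (chain (2 * k + 1).*2) i).
Proof.
move=> lt_i; rewrite /rho ap_prod_transp ?graph_edges_deg //.
  by rewrite tail_edgesE walk_cat.
rewrite all_cat all_chain ?tail_edgesE /=; lia.
Qed.

(* The last fourteen vertices x_(n-13), .., x_(n-7), y_1, .., y_7 are the numbers [4 * k + 1 + c] with
   [c < 14]; [rmove j] is the action of rho_j on the offsets [c], for j > 0.  The pair (0, 1) is the last edge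
   of the chain that carries the label 1. Partners have offsets [c] and [13 - c]. *)
Definition rmove j c := walk j tail14 (if j == 1 then swapn 0 1 c else c).

(** On the numbers below [4 * k + 1] only rho_1 acts among rho_1, rho_2, rho_3: it fixes x_1 and
    swaps the other 4k vertices in consecutive pairs, so this part is invariant. *)
Definition lmove j i :=
  if (j == 1) && (0 < i) then (if odd i then i.+1 else i.-1) else i.

Lemma ap_rho_right k j c : 0 < j -> c < 14 ->
  ap (rho (deg k) j) (4 * k + 1 + c) = 4 * k + 1 + rmove j c.
Proof.
move=> j_gt0 lt_c; rewrite ap_rho_walk; last lia.
rewrite walk_chain /rmove -walk_shift; congr (walk _ _ _); rewrite /swapn.
move: j j_gt0 => [|[|j]] //= _; move: c lt_c => [|[|c]] lt_c; repeat case: ifP => /=; lia.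
Qed.

Lemma ap_rho_left k j i : 0 < j -> i < 4 * k + 1 -> ap (rho (deg k) j) i = lmove j i.
Proof.
move=> j_gt0 lt_i; rewrite ap_rho_walk; last lia.
rewrite walk_chain walk_shift_lt /lmove; move: j j_gt0 => [|[|j]] //= _;
  repeat case: ifP; lia.
Qed.

Lemma ap_rho0 k i : i < deg k -> ap (rho (deg k) 0) i =
  if i < 4 * k + 4 then (if odd i then i.-1 else i.+1) else i.
Proof.
move=> lt_i; rewrite ap_rho_walk // walk_chain /walk /= /swapn.
repeat case: ifP; lia.
Qed.

(** * Words in the generators *)

(** Induction on the size of the symmetric difference of J and K. *)
Lemma intersection_of_pairs (gT : finGroupType) r (s : 'I_r -> gT) :
  (forall (T : {set 'I_r}) i j, i != j -> i \notin T -> j \notin T ->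
     <<s @: (i |: T)>>%g :&: <<s @: (j |: T)>>%g \subset <<s @: T>>%g) ->
  intersection_property s.
Proof.
move=> pairs.
have sub (J K : {set 'I_r}): J \subset K -> <<s @: J>>%g \subset <<s @: K>>%g.
  by move=> sJK; rewrite genS ?imsetS.
suff IH d (J K : {set 'I_r}): #|J :\: K| + #|K :\: J| < d ->
    <<s @: J>>%g :&: <<s @: K>>%g \subset <<s @: (J :&: K)>>%g.
  move=> J K; apply/eqP; rewrite eqEsubset (IH _ J K (ltnSn _)) subsetI.
  by rewrite !sub ?subsetIl ?subsetIr.
elim: d J K => // d IHd J K; rewrite ltnS => le_d.
have [sJK|/subsetPn[i Ji K'i]] := boolP (J \subset K).
  by rewrite (setIidPl sJK) subsetIl.
have [sKJ|/subsetPn[j Kj J'j]] := boolP (K \subset J).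
  by rewrite (setIidPr sKJ) subsetIr.
have neq_ij: i != j by apply: contraNneq K'i => ->.
(* J lies in [i |: T] and K in [j |: T], so the hypothesis puts x in the span of T. *)
pose T := (J :|: K) :\ i :\ j.
have Ti: i \notin T by rewrite !inE eqxx !andbF.
have Tj: j \notin T by rewrite !inE eqxx.
have cJK: #|J :\: K| = #|J :\ i :\: K|.+1.
  rewrite (cardsD1 i) !inE Ji K'i add1n; congr (#|pred_of_set _|.+1).
  by apply/setP=> x; rewrite !inE; case: (x == i); rewrite ?andbF.
have cKJ: #|K :\: J| = #|K :\ j :\: J|.+1.
  rewrite (cardsD1 j) !inE Kj J'j add1n; congr (#|pred_of_set _|.+1).
  by apply/setP=> x; rewrite !inE; case: (x == j); rewrite ?andbF.
apply/subsetP=> x /setIP[xJ xK].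
have neqi y: y \in K -> y != i by move=> Ky; apply: contraNneq K'i => <-.
have neqj y: y \in J -> y != j by move=> Jy; apply: contraNneq J'j => <-.
have xT: x \in <<s @: T>>%g.
  apply: (subsetP (pairs T i j neq_ij Ti Tj)); rewrite inE.
  apply/andP; split; [move: xJ | move: xK]; apply/subsetP/sub; apply/subsetP=> y Hy.
    by rewrite !inE Hy neqj //=; case: eqP.
  by rewrite !inE Hy neqi //= orbT andbT; case: eqP.
have meet A B: #|A :\: B| + #|B :\: A| < d ->
    x \in <<s @: A>>%g -> x \in <<s @: B>>%g -> x \in <<s @: (A :&: B)>>%g.
  by move=> lt_d xA xB; apply: (subsetP (IHd A B lt_d)); rewrite inE xA.
(* J and T differ by i and by all of [K :\: J] but j, which is fewer elements than before; the same
   holds for K and T. *)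
have xJi: x \in <<s @: (J :\ i)>>%g.
  have -> : J :\ i = J :&: T.
    apply/setP=> y; rewrite !inE; case: (boolP (y \in J)) => Jy; rewrite ?andbF //.
    by rewrite neqj ?andbT.
  apply: meet => //; rewrite (leq_trans _ le_d) // cJK cKJ addSn ltnS.
  have ->: J :\: T = [set i].
    apply/setP=> y; rewrite !inE; case: (boolP (y \in J)) => Jy.
      by rewrite neqj //= !andbT negbK.
    by rewrite andbF; apply/esym/eqP => def_y; rewrite def_y Ji in Jy.
  rewrite cards1 add1n addnS ltnS (leq_trans _ (leq_addl _ _)) // subset_leq_card //.
  apply/subsetP=> y; rewrite !inE; case: (y \in J) => //=.
  by case/and3P=> -> _ ->.
have xKj: x \in <<s @: (K :\ j)>>%g.
  have -> : K :\ j = K :&: T.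
    apply/setP=> y; rewrite !inE; case: (boolP (y \in K)) => Ky; rewrite ?andbF //.
    by rewrite neqi // orbT.
  apply: meet => //; rewrite (leq_trans _ le_d) // cJK cKJ addnS ltnS.
  have ->: K :\: T = [set j].
    apply/setP=> y; rewrite !inE; case: (boolP (y \in K)) => Ky.
      by rewrite neqi //= orbT !andbT negbK.
    by rewrite andbF; apply/esym/eqP => def_y; rewrite def_y Kj in Ky.
  rewrite cards1 add1n addSn ltnS (leq_trans _ (leq_addr _ _)) // subset_leq_card //.
  apply/subsetP=> y; rewrite !inE; case: (y \in K) => //=; rewrite orbF.
  by case/and3P=> _ -> ->.
suff: x \in <<s @: ((J :\ i) :&: (K :\ j))>>%g.
  by apply/subsetP/sub; rewrite setISS ?subsetDl.
apply: meet => //; rewrite (leq_trans _ le_d) // cJK cKJ addSn ltnS.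
have -> : J :\ i :\: (K :\ j) = J :\ i :\: K.
  by apply/setP=> y; rewrite !inE negb_and negbK; case: eqP => // ->; rewrite (negPf J'j) !andbF.
have -> : K :\ j :\: (J :\ i) = K :\ j :\: J.
  by apply/setP=> y; rewrite !inE negb_and negbK; case: eqP => // ->; rewrite (negPf K'i) !andbF.
by rewrite addnS ltnW.
Qed.

Definition pw k w := (\prod_(j <- w) rho (deg k) j)%g.
Definition rword w c := foldl (fun c j => rmove j c) c w.
(** The bound keeps numbers from 4 on, which [inord] collapses to 0, from counting as letters. *)
Definition letter (J : {set 'I_4}) (j : nat) := (j < 4) && (inord j \in J).

Lemma pw_cat k u v : pw k (u ++ v) = (pw k u * pw k v)%g.
Proof. exact: big_cat. Qed.

Lemma pw_cons k j v : pw k (j :: v) = (rho (deg k) j * pw k v)%g.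
Proof. exact: big_cons. Qed.

Lemma mem_span_word k (J : {set 'I_4}) w : all (letter J) w -> pw k w \in span k J.
Proof.
move=> /allP Jw; rewrite /pw big_seq group_prod // => j /Jw/andP[lt_j Jj].
by rewrite mem_gen //; apply/imsetP; exists (inord j); rewrite // /rho4 inordK.
Qed.

Lemma span_word k (J : {set 'I_4}) x :
  x \in span k J -> exists2 w, all (letter J) w & x = pw k w.
Proof.
case/gen_prodgP=> n [c Jc ->]; elim: n c Jc => [|n IHn] c Jc.
  by exists [::]; rewrite // /pw big_nil big_ord0.
case: (IHn (fun i => c (lift ord0 i)) (fun i => Jc _)) => w Jw def_x.
have /imsetP[j Jj def_c] := Jc ord0; exists ((j : nat) :: w).
  by rewrite /= Jw /letter ltn_ord inord_val Jj.
by rewrite big_ord_recl def_x pw_cons def_c.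
Qed.

Lemma lt14P (P : pred nat) c : all P (iota 0 14) -> c < 14 -> P c.
Proof. by move/allP=> allP lt_c; rewrite allP // mem_iota. Qed.

(** Reduces a claim about three generators and fourteen offsets to a boolean evaluation. *)
Lemma rmoveP (P : nat -> nat -> bool) j c :
  all (fun j => all (P j) (iota 0 14)) (iota 1 3) -> 0 < j < 4 -> c < 14 -> P j c.
Proof.
move=> /allP allP lt_j lt_c; apply: lt14P lt_c; apply: allP.
by rewrite mem_iota.
Qed.

Lemma rmove_lt14 j c : 0 < j < 4 -> c < 14 -> rmove j c < 14.
Proof.
by apply: (rmoveP (P := fun j c => rmove j c < 14)); vm_compute.
Qed.

Lemma rmoveK j c : 0 < j < 4 -> c < 14 -> rmove j (rmove j c) = c.
Proof.
move=> lt_j lt_c; apply/eqP; move: lt_j lt_c.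
by apply: (rmoveP (P := fun j c => rmove j (rmove j c) == c)); vm_compute.
Qed.

(** The reflection of the offsets preserves the edges of labels 1, 2 and 3; the edge of label 0 on
    offsets 1 and 2 has no mirror image. *)
Lemma rmove_partner j c : 0 < j < 4 -> c < 14 -> rmove j (13 - c) = 13 - rmove j c.
Proof.
move=> lt_j lt_c; apply/eqP; move: lt_j lt_c.
by apply: (rmoveP (P := fun j c => rmove j (13 - c) == 13 - rmove j c)); vm_compute.
Qed.

Lemma rword_lt14 w c : all (fun j => 0 < j < 4) w -> c < 14 -> rword w c < 14.
Proof.
elim: w c => //= j w IHw c /andP[lt_j lt_w] lt_c.
by apply: IHw; rewrite ?rmove_lt14.
Qed.

Lemma ap_word_right k w c : all (fun j => 0 < j < 4) w -> c < 14 ->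
  ap (pw k w) (4 * k + 1 + c) = 4 * k + 1 + rword w c.
Proof.
elim: w c => [|j w IHw] c /=; first by move=> _ lt_c; rewrite /pw big_nil ap1 //; lia.
case/andP=> lt_j lt_w lt_c; rewrite pw_cons apM ap_rho_right //; last by case/andP: lt_j.
by rewrite IHw // rmove_lt14.
Qed.

Lemma ap_word_left k w i : all (fun j => 0 < j) w -> i < 4 * k + 1 ->
  ap (pw k w) i = if odd (count_mem 1 w) then lmove 1 i else i.
Proof.
elim: w i => [|j w IHw] i /=; first by move=> _ lt_i; rewrite /pw big_nil ap1 //; lia.
case/andP=> j_gt0 lt_w lt_i; rewrite pw_cons apM ap_rho_left // IHw //.
  rewrite oddD /lmove; case: (eqVneq j 1) => //= _.
  case: odd => /=; repeat case: ifP; lia.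
by rewrite /lmove; repeat case: ifP; lia.
Qed.

(** The parity of the number of letters 1 decides the action on the left part, which for [k = 0] is
    the fixed vertex x_1 alone. *)
Lemma eq_pw k u v :
    all (fun j => 0 < j < 4) u -> all (fun j => 0 < j < 4) v ->
    (forall c, c < 14 -> rword u c = rword v c) ->
    odd (count_mem 1 u) = odd (count_mem 1 v) \/ k = 0 ->
  pw k u = pw k v.
Proof.
move=> lt_u lt_v eq_r eq_l; apply: eq_ap => i lt_i.
have [lt_im|le_mi] := ltnP i (4 * k + 1); last first.
  by rewrite -(subnKC le_mi) !ap_word_right ?eq_r //; lia.
have gt0 w: all (fun j => 0 < j < 4) w -> all (fun j => 0 < j) w.
  by apply: sub_all => j /andP[].
rewrite !ap_word_left ?gt0 //; case: eq_l => [-> //|k0].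
have ->: i = 0 by lia.
by rewrite /lmove !if_same.
Qed.

Lemma rword_partner w c : all (fun j => 0 < j < 4) w -> c < 14 ->
  rword w (13 - c) = 13 - rword w c.
Proof.
elim: w c => //= j w IHw c /andP[lt_j lt_w] lt_c.
by rewrite rmove_partner // IHw // rmove_lt14.
Qed.

(* rho_0 fixes {y_1, .., y_7} pointwise, so its occurrences can be deleted. *)
Lemma ap_word_Y k w c : all (fun j => j < 3) w -> 7 <= c < 14 ->
  let c' := rword (filter (predC1 0) w) c in
  ap (pw k w) (4 * k + 1 + c) = 4 * k + 1 + c' /\ 7 <= c' < 14.
Proof.
elim: w c => [|j w IHw] c /=; first by move=> _ lt_c; rewrite /pw big_nil ap1 //; lia.
case/andP=> lt_j lt_w lt_c; rewrite pw_cons apM.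
case: (posnP j) => [->|j_gt0] /=.
  by rewrite ap_rho0 ?ifF; [apply: IHw | lia..].
rewrite ap_rho_right //; last lia.
apply: IHw => //.
have [/andP[ge7 lt14] lt_j4]: 7 <= c < 14 /\ 0 < j < 4 by split=> //; lia.
move: ge7; apply/implyP; apply: implyP lt_j.
move: lt_j4 lt14.
by apply: (rmoveP (P := fun j c => (j < 3) ==> (7 <= c) ==> (7 <= rmove j c < 14))); vm_compute.
Qed.

Lemma rho_sq k j : j < 4 -> (rho (deg k) j * rho (deg k) j = 1)%g.
Proof.
move=> lt_j; case: (posnP j) => [->|j_gt0].
  apply: eq_ap => i lt_i; rewrite apM ap1 // !ap_rho0 //; repeat case: ifP; lia.
have := @eq_pw k [:: j; j] [::]; rewrite !pw_cons /pw big_nil mulg1; apply=> //=.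
- by rewrite j_gt0 lt_j.
- by move=> c lt_c; rewrite /rword /= rmoveK ?j_gt0.
by left; case: eqP.
Qed.

Lemma ap_rho0_right k c : 0 < c < 14 ->
  ap (rho (deg k) 0) (4 * k + 1 + c) = 4 * k + 1 + swapn 1 2 c.
Proof.
move=> lt_c; rewrite ap_rho0; last lia.
by rewrite /swapn; repeat case: ifP; lia.
Qed.

(** Up to offset 0, rho_j is trivial; beyond it, rho_0 only swaps offsets 1 and 2, an edge that
    rho_2 shares and rho_3 avoids. *)
Lemma rho0_comm k j : 1 < j < 4 -> commute (rho (deg k) 0) (rho (deg k) j).
Proof.
move=> lt_j; apply: eq_ap => i lt_i; rewrite !apM.
have fixm: ap (rho (deg k) j) (4 * k + 1) = 4 * k + 1.
  have:= @ap_rho_right k j 0; rewrite !addn0 => -> //; last lia.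
  by move: j lt_j => [|[|[|[|j]]]] // _; rewrite addn0.
have fixl x: x < 4 * k + 1 -> ap (rho (deg k) j) x = x.
  by move=> lt_x; rewrite ap_rho_left //; [rewrite /lmove ifF; lia | lia].
have [lt_im|le_mi] := ltnP i (4 * k + 1).
  rewrite (fixl i) // !ap_rho0 // ifT; last lia.
  case: ifP => odd_i; first by rewrite fixl; lia.
  have [->|neq_i] := eqVneq i (4 * k); first by rewrite -[(4 * k).+1]addn1.
  by rewrite fixl; lia.
have [->|neq_i] := eqVneq i (4 * k + 1).
  rewrite fixm ap_rho0; last lia.
  by rewrite fixl //; repeat case: ifP; lia.
have [c def_i lt_c]: exists2 c, i = 4 * k + 1 + c & 0 < c < 14.
  by exists (i - (4 * k + 1)); lia.
have [eq_c lt_c']: rmove j (swapn 1 2 c) = swapn 1 2 (rmove j c) /\ 0 < rmove j c < 14.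
  have := rmoveP (P := fun j c => (1 < j) ==> (0 < c) ==>
    (rmove j (swapn 1 2 c) == swapn 1 2 (rmove j c)) && (0 < rmove j c < 14)) (erefl true).
  move=> /(_ j c); case/andP: lt_j => j_gt1 lt_j; case/andP: lt_c => c_gt0 lt_c.
  by rewrite lt_j (ltnW j_gt1) j_gt1 c_gt0 => /(_ isT lt_c)/andP[/eqP].
have j_gt0: 0 < j by case/andP: lt_j => /ltnW.
rewrite def_i ap_rho0_right // !(ap_rho_right k j_gt0) ?ap_rho0_right ?eq_c //.
  by case/andP: lt_c.
by rewrite /swapn; repeat case: ifP; lia.
Qed.

Lemma rho13_comm k : commute (rho (deg k) 1) (rho (deg k) 3).
Proof.
have := @eq_pw k [:: 1; 3] [:: 3; 1]; rewrite !pw_cons /pw big_nil !mulg1; apply=> //=; last by left.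
by move=> c lt_c; apply/eqP/(lt14P (P := fun c => rmove 3 (rmove 1 c) == rmove 1 (rmove 3 c))).
Qed.

Lemma pw_commute k i w : i < 4 ->
    (forall j, j \in w -> commute (rho (deg k) i) (rho (deg k) j)) ->
  pw k w = (rho (deg k) i ^+ count_mem i w * pw k (filter (predC1 i) w))%g.
Proof.
move=> lt_i; elim: w => [|j w IHw] comm_w; first by rewrite /= mul1g.
have cw l: l \in w -> commute (rho (deg k) i) (rho (deg k) l).
  by move=> wl; apply: comm_w; rewrite inE wl orbT.
rewrite pw_cons {}IHw //=; case: (eqVneq j i) => [->|_] /=.
  by rewrite add1n expgS mulgA.
by rewrite pw_cons !mulgA add0n (commuteX _ (commute_sym (comm_w j (mem_head _ _)))).
Qed.

Lemma rhoX k j a : j < 4 -> (rho (deg k) j ^+ a = if odd a then rho (deg k) j else 1)%g.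
Proof.
move=> lt_j; rewrite -[in LHS](odd_double_half a) expgD -mul2n expgM.
by rewrite [(_ ^+ 2)%g]rho_sq // expg1n mulg1; case: odd.
Qed.

Lemma dihedral_word k i j w : i < 4 -> j < 4 -> all (mem [:: i; j]) w ->
  exists a e, (e < 2) /\ pw k w = ((rho (deg k) i * rho (deg k) j) ^+ a * rho (deg k) j ^+ e)%g.
Proof.
move=> lt_i lt_j; set c := (_ * _)%g.
elim/last_ind: w => [|w l IHw]; first by exists 0, 0; rewrite /pw big_nil mulg1.
rewrite all_rcons => /andP[lt_l /IHw[a [e [lt_e def_w]]]].
have c_inv: (rho (deg k) j * rho (deg k) i = c^-1)%g.
  apply: (mulgI c); rewrite mulgV /c mulgA -(mulgA _ (rho _ j) (rho _ j)) rho_sq //.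
  by rewrite mulg1 rho_sq.
have ci: (rho (deg k) i = c * rho (deg k) j)%g by rewrite /c -mulgA rho_sq // mulg1.
have ->: pw k (rcons w l) = (c ^+ a * rho (deg k) j ^+ e * rho (deg k) l)%g.
  by rewrite -cats1 pw_cat def_w pw_cons /pw big_nil mulg1.
move: lt_l; rewrite /= !inE => /orP[]/eqP->; case: e lt_e {def_w} => [|[|e]] // _.
- by exists a.+1, 1; rewrite mulg1 {1}ci expgSr !mulgA expg1.
(* The inverse of c is written as a power with natural exponent. *)
- exists (a + #[c]%g.-1), 0; split=> //; rewrite expg1 mulg1 -mulgA c_inv expgD.
  by rewrite -invg_expg.
- by exists a, 1; rewrite mulg1.
by exists a, 0; split=> //; rewrite expg1 -mulgA rho_sq.
Qed.

(** * The subgroups <rho_0, rho_1>, <rho_1, rho_2, rho_3> and <rho_0, rho_1, rho_2> *)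

Lemma ap_rho1_path k i : i < 4 * k + 7 ->
  ap (rho (deg k) 1) i = if i == 0 then 0 else if odd i then i.+1 else i.-1.
Proof.
move=> lt_i; have [lt_im|le_mi] := ltnP i (4 * k + 1).
  by rewrite ap_rho_left // /lmove; repeat case: ifP; lia.
have [c def_i lt_c]: exists2 c, i = 4 * k + 1 + c & c < 6 by exists (i - (4 * k + 1)); lia.
rewrite def_i ap_rho_right //; last lia.
have ->: rmove 1 c = if odd c then c.-1 else c.+1.
  by move: c lt_c {def_i} => [|[|[|[|[|[|]]]]]].
by repeat case: ifP; lia.
Qed.

(** The rotation runs up the path x_1, .., x_(n-10) through the even numbers and back through the
    odd ones, a cycle of length 4k + 5. *)
Lemma ap_rot01_end k j : j < 4 * k + 5 ->
  ap (rot01 k ^+ j)%g 0 = if 2 * j < 4 * k + 5 then 2 * j else 2 * (4 * k + 5) - 1 - 2 * j.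
Proof.
elim: j => [|j IHj] lt_j; first by rewrite expg0 ap1 //; case: ifP; lia.
rewrite expgSr apM IHj; last lia.
rewrite apM ap_rho0; last by case: ifP; lia.
rewrite ap_rho1_path; last by repeat case: ifP; lia.
repeat case: ifP; lia.
Qed.

Lemma ap_rot01_full_end k : ap (rot01 k ^+ (4 * k + 5))%g 0 = 0.
Proof.
have ->: 4 * k + 5 = (4 * k + 4).+1 by lia.
rewrite expgSr apM ap_rot01_end; last lia.
rewrite ifF; last lia.
rewrite apM ap_rho0; last lia.
by rewrite ap_rho1_path; repeat case: ifP; lia.
Qed.

Lemma ap_rot01_full_path k i : i < 4 * k + 5 -> ap (rot01 k ^+ (4 * k + 5))%g i = i.
Proof.
move=> lt_i.
have [j lt_j <-]: exists2 j, j < 4 * k + 5 & ap (rot01 k ^+ j)%g 0 = i.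
  exists (if odd i then (2 * (4 * k + 5) - 1 - i)./2 else i./2); first by case: ifP; lia.
  by rewrite ap_rot01_end; repeat case: ifP; lia.
by rewrite -apM -expgD [j + _]addnC expgD apM ap_rot01_full_end.
Qed.

Lemma ap_rot01_off k q i : 4 * k + 5 <= i < deg k ->
  ap (rot01 k ^+ q)%g i = ap (rho (deg k) 1 ^+ q)%g i /\ 4 * k + 5 <= ap (rot01 k ^+ q)%g i.
Proof.
move=> lt_i; elim: q => [|q [IHq ge_q]]; first by rewrite !expg0 ap1; lia.
have lt_q := ap_lt (rot01 k ^+ q)%g i.
have ->: ap (rot01 k ^+ q.+1)%g i = ap (rho (deg k) 1) (ap (rot01 k ^+ q)%g i).
  by rewrite expgSr !apM ap_rho0 // ltnNge (leq_trans _ ge_q) // leq_add2l.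
split; first by rewrite expgSr apM IHq.
have [c def_c lt_c]: exists2 c, ap (rot01 k ^+ q)%g i = 4 * k + 1 + c & 4 <= c < 14.
  by exists (ap (rot01 k ^+ q)%g i - (4 * k + 1)); lia.
rewrite def_c ap_rho_right //; last by case/andP: lt_c.
suff: 4 <= rmove 1 c by lia.
case/andP: lt_c => ge4 lt14; apply: implyP ge4.
by apply: (lt14P (P := fun c => (4 <= c) ==> (4 <= rmove 1 c))); vm_compute.
Qed.

Lemma rot01_order k : (rot01 k ^+ (2 * (4 * k + 5)) = 1)%g.
Proof.
apply: eq_ap => i lt_i; rewrite ap1 //; have [lt_iL|ge_iL] := ltnP i (4 * k + 5).
  by rewrite [2 * (_ + 5)]mulnC expgM expgS expg1 apM !ap_rot01_full_path.
have [|-> _] := @ap_rot01_off k (2 * (4 * k + 5)) i; first by rewrite ge_iL.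
by rewrite rhoX // oddM /= ap1.
Qed.

Lemma rot01_fix_end k j : ap (rot01 k ^+ j)%g 0 = 0 -> 4 * k + 5 %| j.
Proof.
rewrite {1}(divn_eq j (4 * k + 5)) expgD [_ %/ _ * _]mulnC expgM apM => fix0.
have: ap ((rot01 k ^+ (4 * k + 5)) ^+ (j %/ (4 * k + 5)))%g 0 = 0.
  elim: (_ %/ _) => [|q IHq]; first by rewrite ap1.
  by rewrite expgSr apM IHq ap_rot01_full_end.
have lt_r: j %% (4 * k + 5) < 4 * k + 5 by rewrite ltn_mod addnS.
move=> E; rewrite E ap_rot01_end // in fix0; apply/eqP.
by move: (j %% _) lt_r fix0 => r; case: ifP; lia.
Qed.

(** The path contributes the odd factor [4 * k + 5], the vertices off it the factor 2. *)
Lemma order_rot01 k : #[rot01 k]%g = 2 * (4 * k + 5).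
Proof.
apply/eqP; rewrite eqn_dvd order_dvdn rot01_order eqxx /=.
have e1 := expg_order (rot01 k).
rewrite Gauss_dvd ?rot01_fix_end ?e1 ?ap1 ?andbT //; last by rewrite coprime2n oddD oddM.
rewrite dvdn2; apply/negP => odd_o.
(* Offset 12 is y_6, which rho_1 swaps with y_7, so an odd power moves it. *)
have [] := @ap_rot01_off k #[rot01 k]%g (4 * k + 1 + 12); first lia.
rewrite e1 ap1; last lia.
by rewrite rhoX // odd_o ap_rho_right // => /addnI.
Qed.

(** * The subgroups omitting rho_0 or rho_3 *)

Definition n123 : {set 'I_4} := [set i : 'I_4 | 0 < i].
Definition n012 : {set 'I_4} := [set i : 'I_4 | i < 3].

Lemma span_n123 k x : x \in span k n123 ->
  exists2 w, all (fun j => 0 < j < 4) w & x = pw k w.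
Proof.
case/span_word=> w /allP Jw ->; exists w => //; apply/allP=> j /Jw/andP[lt_j].
by rewrite inE inordK // => ->.
Qed.

Lemma span_n012 k x : x \in span k n012 ->
  exists2 w, all (fun j => j < 3) w & x = pw k w.
Proof.
case/span_word=> w /allP Jw ->; exists w => //; apply/allP=> j /Jw/andP[lt_j].
by rewrite inE inordK.
Qed.

Lemma n123_fix0 k x : x \in span k n123 -> ap x 0 = 0.
Proof.
case/span_n123=> w lt_w ->; rewrite ap_word_left ?addn1 //; first by rewrite if_same.
by apply: sub_all lt_w => j /andP[].
Qed.

Lemma n012_Y k x c : x \in span k n012 -> 7 <= c < 14 ->
  4 * k + 8 <= ap x (4 * k + 1 + c).
Proof.
case/span_n012=> w lt_w -> lt_c; have [-> /andP[ge7 _]] := ap_word_Y k lt_w lt_c.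
lia.
Qed.

Lemma rho_span k (J : {set 'I_4}) j : letter J j -> rho (deg k) j \in span k J.
Proof.
by move=> Jj; have := @mem_span_word k J [:: j]; rewrite /pw big_seq1 /= Jj; apply.
Qed.

Lemma rho0_fix0 k : ap (rho (deg k) 0) 0 = 1.
Proof. by rewrite ap_rho0 ?addnS. Qed.

(* On the vertices off the path x_1, .., x_(n-10) the rotation rho_0 rho_1 acts as rho_1, so its (n-10)-th
   power, which fixes that path, separates the partners x_(n-10) and y_4. *)
Lemma dihedral01_cap_n123 k w : all (mem [:: 0; 1]) w -> pw k w \in span k n123 ->
  exists e, pw k w = (rho (deg k) 1 ^+ e)%g.
Proof.
move=> w01 xs; have fix0 := n123_fix0 xs.
have [v lt_v def_v] := span_n123 xs.
have [a [e [lt_e def_x]]] := @dihedral_word k 0 1 w isT isT w01.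
have fix1: ap (rho (deg k) 1) 0 = 0 by rewrite ap_rho_left ?addn1.
have /rot01_fix_end/dvdnP[q def_a]: ap (rot01 k ^+ a)%g 0 = 0.
  move: fix0; rewrite def_x apM rhoX //; case: odd => fix0; last by rewrite ap1 ?ap_lt in fix0.
  by apply: (@ap_inj _ (rho (deg k) 1)); rewrite ?ap_lt // fix0 fix1.
exists e; rewrite def_x; have [odd_q|ev_q] := boolP (odd q); last first.
  have ->: a = 2 * (4 * k + 5) * q./2 by rewrite def_a; lia.
  by rewrite expgM rot01_order expg1n mul1g.
have x3: ap (pw k w) (4 * k + 1 + 3) = 4 * k + 1 + (if e == 1 then 2 else 3).
  rewrite def_x apM def_a [q * _]mulnC expgM.
  have ->: ap ((rot01 k ^+ (4 * k + 5)) ^+ q)%g (4 * k + 1 + 3) = 4 * k + 1 + 3.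
    elim: (q) => [|r IHr]; first by rewrite ap1 //; lia.
    by rewrite expgSr apM IHr ap_rot01_full_path //; lia.
  by case: e lt_e {def_x} => [|[|]] // _; [rewrite ap1 //; lia | rewrite expg1 ap_rho_right].
have x10: ap (pw k w) (4 * k + 1 + 10) = 4 * k + 1 + (if e == 1 then 10 else 11).
  rewrite def_x apM def_a.
  have [|-> _] := @ap_rot01_off k (q * (4 * k + 5)) (4 * k + 1 + 10); first lia.
  have odd_a: odd (q * (4 * k + 5)) by rewrite oddM odd_q /=; lia.
  rewrite [(_ ^+ (q * _))%g]rhoX // odd_a ap_rho_right //; have ->: rmove 1 10 = 11 by [].
  by case: e lt_e {def_x x3} => [|[|]] // _; [rewrite ap1 //; lia | rewrite expg1 ap_rho_right].
(* The images of the partners 3 and 10 are 3 and 11, or 2 and 10, and neither pair has sum 13. *)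
have := @rword_partner v 3 lt_v isT; move: x3 x10; rewrite def_v !ap_word_right //.
by move=> /addnI-> /addnI->; case: e {lt_e def_x} => [|[|]].
Qed.

(* An element of both subgroups preserves {y_1, .., y_7}, where it acts as a word in rho_1 and rho_2; as it
   commutes with the partner involution, it acts as that word on all fourteen vertices.  The remaining
   sign, the action of rho_1 on the left part, is that of (rho_1 rho_2)^7. *)
Lemma n123_cap_n012 k (x : {perm 'I_(deg k)}) : x \in span k n123 -> x \in span k n012 ->
  exists2 w, all (mem [:: 1; 2]) w & x = pw k w.
Proof.
move=> /span_n123[u lt_u ->] /span_n012[v lt_v eq_uv].
pose v' := filter (predC1 0) v.
have v'12: all (mem [:: 1; 2]) v'.
  apply/allP=> j; rewrite mem_filter /= => /andP[j0 /(allP lt_v)].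
  by case: j j0 => [|[|[|]]].
have lt_v': all (fun j => 0 < j < 4) v' by apply: sub_all v'12 => j; rewrite !inE => /orP[]/eqP->.
have eqY c: 7 <= c < 14 -> rword u c = rword v' c.
  move=> lt_c; have [] := @ap_word_Y k v c lt_v lt_c.
  by rewrite -eq_uv ap_word_right //; [move/addnI | case/andP: lt_c].
have eqr c: c < 14 -> rword u c = rword v' c.
  move=> lt_c; have [ge_c|lt7] := leqP 7 c; first by apply: eqY; rewrite ge_c.
  have lt_c': 13 - c < 14 by lia.
  have ->: c = 13 - (13 - c) by lia.
  by rewrite (rword_partner lt_u lt_c') (rword_partner lt_v' lt_c') eqY //; lia.
have [eq_p|neq_p] := eqVneq (odd (count_mem 1 u)) (odd (count_mem 1 v')).
  by exists v' => //; apply: eq_pw => //; left.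
(* On the fourteen offsets rho_1 rho_2 consists of two 7-cycles, so [t] is trivial there, yet it has
   an odd number of letters 1. *)
pose t := flatten (nseq 7 [:: 1; 2]).
exists (v' ++ t); first by rewrite all_cat v'12.
apply: eq_pw => //.
- by rewrite all_cat lt_v'.
- move=> c lt_c; rewrite eqr // /rword foldl_cat -!/(rword _ _).
  have := rword_lt14 lt_v' lt_c; move: (rword v' c) => d lt_d.
  apply/esym/eqP; move: lt_d.
  by apply: (lt14P (P := fun d => rword t d == d)); vm_compute.
left; rewrite count_cat oddD; move: neq_p; have ->: odd (count_mem 1 t) by [].
by case: odd; case: odd.
Qed.

(** * The intersection property and the Schlafli type *)

Lemma letterU1 i (T : {set 'I_4}) j : i < 4 ->
  letter (inord i |: T) j = (j == i) || letter T j.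
Proof.
move=> lt_i; rewrite /letter !inE; have [lt_j|ge_j] /= := ltnP j 4; last first.
  by rewrite orbF; apply/esym/eqP; lia.
by congr (_ || _); rewrite -val_eqE /= !inordK.
Qed.

Lemma letter_lt (T : {set 'I_4}) j : letter T j -> j < 4.
Proof. by case/andP. Qed.

Lemma span_sub k (J K : {set 'I_4}) x :
  (forall j, letter J j -> letter K j) -> x \in span k J -> x \in span k K.
Proof.
move=> sJK /span_word[w Jw ->]; apply: mem_span_word; exact: sub_all Jw.
Qed.

Lemma letter123 j : letter n123 j = (0 < j < 4).
Proof.
by rewrite /letter inE; have [lt_j|] := ltnP j 4; rewrite ?andbF // inordK ?andbT.
Qed.

Lemma letter012 j : letter n012 j = (j < 3).
Proof.
rewrite /letter inE; have [lt_j|] := ltnP j 4; first by rewrite inordK.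
lia.
Qed.

(** Collecting a generator that commutes with all of J leaves a word of smaller rank. *)
Lemma split_letter k (J T : {set 'I_4}) i x : i < 4 ->
    (forall j, letter J j -> commute (rho (deg k) i) (rho (deg k) j)) ->
    x \in span k J -> (letter J i -> letter T i) ->
  exists a w, [/\ x = (rho (deg k) i ^+ a * pw k w)%g, (rho (deg k) i ^+ a)%g \in span k T
    & all (fun j => letter J j && (j != i)) w].
Proof.
move=> lt_i comm_i /span_word[w Jw ->] JTi.
exists (count_mem i w), (filter (predC1 i) w); split.
- by apply: pw_commute => // j /(allP Jw)/comm_i.
- have [/JTi Ti|J'i] := boolP (letter J i); first by rewrite groupX ?rho_span.
  have /count_memPn->: i \notin w by apply: contra J'i => /(allP Jw).
  by rewrite expg0 group1.
by apply/allP=> j; rewrite mem_filter /= => /andP[-> /(allP Jw)->].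
Qed.

Lemma rho_commute k i j : i < 4 -> j < 4 -> [|| i == j, i + 2 <= j | j + 2 <= i] ->
  commute (rho (deg k) i) (rho (deg k) j).
Proof.
have comm_lt a b : b < 4 -> a + 2 <= b -> commute (rho (deg k) a) (rho (deg k) b).
  move=> lt_b le_ab; have [->|a0] := posnP a; first by apply: rho0_comm; lia.
  have ->: a = 1 by lia.
  have ->: b = 3 by lia.
  exact: rho13_comm.
move=> lt_i lt_j /or3P[/eqP-> //|/comm_lt|/comm_lt]; first exact.
by move=> H; apply/commute_sym/H.
Qed.

Definition word23 (j e : nat) := flatten (nseq j [:: 2; 3]) ++ nseq e 3.

Lemma pw_nseq k j (w : seq nat) : pw k (flatten (nseq j w)) = (pw k w ^+ j)%g.
Proof.
elim: j => [|j IHj]; first by rewrite /pw big_nil.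
by rewrite /= pw_cat IHj expgS.
Qed.

Lemma all_word23 (P : pred nat) j e : P 2 -> P 3 -> all P (word23 j e).
Proof.
move=> P2 P3; rewrite all_cat all_nseq P3 orbT andbT.
by elim: j => //= j ->; rewrite P2 P3.
Qed.

Lemma rho23_order k : ((rho (deg k) 2 * rho (deg k) 3) ^+ 4 = 1)%g.
Proof.
have := @eq_pw k (flatten (nseq 4 [:: 2; 3])) [::].
rewrite pw_nseq !pw_cons /pw !big_nil mulg1; apply => //; last by left.
move=> c lt_c; apply/eqP; move: lt_c.
by apply: (lt14P (P := fun c => rword (flatten (nseq 4 [:: 2; 3])) c == c)); vm_compute.
Qed.

Lemma dihedral23_word k w : all (mem [:: 2; 3]) w ->
  exists j e, [/\ j < 4, e < 2 & pw k w = pw k (word23 j e)].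
Proof.
move=> w23; have [j [e [lt_e ->]]] := @dihedral_word k 2 3 w isT isT w23.
exists (j %% 4), e; split; rewrite ?ltn_mod // pw_cat pw_nseq !pw_cons /pw big_nil mulg1.
rewrite {1}(divn_eq j 4) expgD [_ %/ _ * _]mulnC expgM rho23_order expg1n mul1g; congr (_ * _)%g.
by elim: e {lt_e} => [|e IHe]; rewrite ?big_nil //= big_cons -IHe expgS.
Qed.

Lemma word23P (P : nat -> nat -> bool) j e :
  all (fun j => all (P j) (iota 0 2)) (iota 0 4) -> j < 4 -> e < 2 -> P j e.
Proof.
move=> all_P lt_j lt_e; have /allP all_e: all (P j) (iota 0 2).
  by apply: (allP all_P); rewrite mem_iota.
by apply: all_e; rewrite mem_iota.
Qed.

(** The group <rho_2, rho_3> acts on the path y_1, y_2, x_(n-9), x_(n-10) as the dihedral group of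
    order 8, where the stabiliser of the end y_1 is <rho_3>. *)
Lemma word23_fix_y1 k j e : j < 4 -> e < 2 ->
  ap (pw k (word23 j e)) (4 * k + 8) = 4 * k + 8 -> j = 0.
Proof.
move=> lt_j lt_e; rewrite (_ : 4 * k + 8 = 4 * k + 1 + 7); last by rewrite -addnA.
rewrite ap_word_right ?all_word23 // => /addnI/eqP fix7; apply/eqP.
move: fix7; apply/implyP; move: lt_j lt_e.
by apply: (word23P (P := fun j e => (rword (word23 j e) 7 == 7) ==> (j == 0))); vm_compute.
Qed.

Lemma word23_n012 k j e : j < 4 -> e < 2 -> pw k (word23 j e) \in span k n012 ->
  pw k (word23 j e) = 1%g \/ pw k (word23 j e) = rho (deg k) 2.
Proof.
move=> lt_j lt_e xY; have := n012_Y xY (_ : 7 <= 7 < 14); have := n012_Y xY (_ : 7 <= 8 < 14).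
rewrite !ap_word_right ?all_word23 // => /(_ isT) Y8 /(_ isT) Y7.
have Y78: (7 <= rword (word23 j e) 7) && (7 <= rword (word23 j e) 8) by lia.
have: ((j, e) == (0, 0)) || ((j, e) == (1, 1)).
  move: Y78; apply/implyP; move: lt_j lt_e.
  apply: (word23P (P := fun j e => (7 <= rword (word23 j e) 7) && (7 <= rword (word23 j e) 8)
    ==> ((j, e) == (0, 0)) || ((j, e) == (1, 1)))); by vm_compute.
case/orP=> /eqP[-> ->]; first by left; rewrite /pw big_nil.
by right; rewrite !pw_cons /pw big_nil mulg1 rho_sq ?mulg1.
Qed.

(** The pairs with i = 0, with <j, T> enlarged to <rho_1, rho_2, rho_3>. *)
Lemma meet_n123 k (T : {set 'I_4}) j x : ~~ letter T 0 -> 0 < j < 4 -> ~~ letter T j ->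
  x \in span k (inord 0 |: T) -> x \in span k n123 -> x \in span k T.
Proof.
move=> T'0 lt_j T'j xT x123.
have JT l : letter (inord 0 |: T) l -> (l == 0) || letter T l by rewrite letterU1.
have T123 l : letter T l -> letter n123 l.
  move=> Tl; rewrite letter123 (letter_lt Tl) andbT lt0n.
  by apply: contraNneq T'0 => <-.
(* Without rho_1 in T, rho_0 splits off; it moves x_1, which x and the remaining word fix, so its
   exponent is even. *)
have [T1|T'1] := boolP (letter T 1); last first.
  have [|//|a [w [def_x _ /allP Jw]]] := @split_letter k _ (inord 0 |: T) 0 x isT _ xT.
    move=> l Jl; apply: rho_commute => //; first exact: letter_lt Jl.
    case: l {Jl} (JT l Jl) => [|[|l]] //=; first by rewrite (negPf T'1).
  have Tw: all (letter T) w.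
    by apply/allP=> l /Jw/andP[/JT/orP[->|]].
  have wT := mem_span_word k Tw; move: def_x; rewrite rhoX //.
  case: odd => def_x; last by rewrite def_x mul1g.
  have fixw := n123_fix0 (span_sub T123 wT).
  have /ap_inj eq10: ap (pw k w) 1 = ap (pw k w) 0.
    by rewrite fixw -(rho0_fix0 k) -apM -def_x (n123_fix0 x123).
  have lt1: 1 < deg k by rewrite addnS.
  by have := eq10 lt1 isT.
(* Without rho_2, rho_3 splits off and a word in rho_0 and rho_1 remains. *)
have [T2|T'2] := boolP (letter T 2); last first.
  have [||a [w [def_x aT /allP Jw]]] := @split_letter k _ T 3 x isT _ xT.
  - move=> l Jl; apply: rho_commute => //; first exact: letter_lt Jl.
    case: l {Jl} (JT l Jl) (letter_lt Jl) => [|[|[|[|l]]]] //=; first by rewrite (negPf T'2).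
  - by move/JT.
  rewrite def_x groupM //.
  have w01: all (mem [:: 0; 1]) w.
    apply/allP=> l /Jw/andP[Jl]; move: (JT l Jl) (letter_lt Jl).
    by case: l {Jl} => [|[|[|[|l]]]] //=; rewrite (negPf T'2).
  have w123: pw k w \in span k n123.
    by rewrite -(groupMl _ (span_sub T123 aT)) -def_x.
  have [e ->] := dihedral01_cap_n123 w01 w123.
  by rewrite groupX ?rho_span.
have j3: j = 3 by case: j lt_j T'j => [|[|[|[|]]]] //; rewrite ?T1 ?T2.
have x012: x \in span k n012.
  apply: span_sub xT => l Jl; rewrite letter012; move: (JT l Jl) (letter_lt Jl).
  by case: l {Jl} => [|[|[|[|l]]]] //=; rewrite -j3 (negPf T'j).
have [w w12 ->] := n123_cap_n012 x123 x012; apply: mem_span_word.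
by apply: sub_all w12 => l; rewrite !inE => /orP[]/eqP->.
Qed.

(** The pairs with j = 3: here the invariance of {y_1, .., y_7} plays the part that the fixed vertex
    x_1 has for i = 0. *)
Lemma meet_n012 k (T : {set 'I_4}) j x : ~~ letter T 3 -> j < 3 -> ~~ letter T j ->
  x \in span k (inord 3 |: T) -> x \in span k n012 -> x \in span k T.
Proof.
move=> T'3 lt_j T'j xT x012.
have JT l : letter (inord 3 |: T) l -> (l == 3) || letter T l by rewrite letterU1.
have T012 l : letter T l -> letter n012 l.
  move=> Tl; rewrite letter012; have := letter_lt Tl; rewrite ltnS leq_eqVlt.
  by case/orP=> // /eqP l3; rewrite l3 (negPf T'3) in Tl.
have [T2|T'2] := boolP (letter T 2); last first.
  have [|//|a [w [def_x _ /allP Jw]]] := @split_letter k _ (inord 3 |: T) 3 x isT _ xT.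
    move=> l Jl; apply: rho_commute => //; first exact: letter_lt Jl.
    case: l {Jl} (JT l Jl) (letter_lt Jl) => [|[|[|[|l]]]] //=; by rewrite (negPf T'2).
  have Tw: all (letter T) w.
    by apply/allP=> l /Jw/andP[/JT/orP[/eqP->|]].
  have wT := mem_span_word k Tw; move: def_x; rewrite rhoX //.
  case: odd => def_x; last by rewrite def_x mul1g.
  have rho3Y: rho (deg k) 3 \in span k n012.
    by rewrite -(groupMr _ (span_sub T012 wT)) -def_x.
  (* rho_3 takes y_2, offset 8, to x_(n-9), offset 4. *)
  have := n012_Y rho3Y (_ : 7 <= 8 < 14); rewrite ap_rho_right // => /(_ isT).
  by rewrite (_ : rmove 3 8 = 4) //; lia.
have [T1|T'1] := boolP (letter T 1); last first.
  have [||a [w [def_x aT /allP Jw]]] := @split_letter k _ T 0 x isT _ xT.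
  - move=> l Jl; apply: rho_commute => //; first exact: letter_lt Jl.
    by case: l {Jl} (JT l Jl) => [|[|l]] //=; rewrite (negPf T'1).
  - by move/JT.
  rewrite def_x groupM //.
  have w23: all (mem [:: 2; 3]) w.
    apply/allP=> l /Jw/andP[Jl]; move: (JT l Jl) (letter_lt Jl).
    by case: l {Jl} => [|[|[|[|l]]]] //=; rewrite (negPf T'1).
  have w012: pw k w \in span k n012.
    by rewrite -(groupMl _ (span_sub T012 aT)) -def_x.
  have [b [e [lt_b lt_e def_w]]] := dihedral23_word k w23.
  rewrite def_w in w012 *.
  by have [->|->] := word23_n012 lt_b lt_e w012; rewrite ?group1 ?rho_span.
have j0: j = 0 by case: j lt_j T'j => [|[|[|]]] //; rewrite ?T1 ?T2.
have x123: x \in span k n123.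
  apply: span_sub xT => l Jl; rewrite letter123 (letter_lt Jl) andbT lt0n.
  by apply: contraNneq T'j => l0; move: (JT l Jl); rewrite l0 j0.
have [w w12 ->] := n123_cap_n012 x123 x012; apply: mem_span_word.
by apply: sub_all w12 => l; rewrite !inE => /orP[]/eqP->.
Qed.

(** All generators but rho_2 fix y_1, hence so does x; after rho_0 splits off, a word in rho_2 and
    rho_3 fixing y_1 remains. *)
Lemma meet_12 k (T : {set 'I_4}) x : ~~ letter T 1 -> ~~ letter T 2 ->
  x \in span k (inord 1 |: T) -> x \in span k (inord 2 |: T) -> x \in span k T.
Proof.
move=> T'1 T'2 x1 x2.
have JT i l : i < 4 -> letter (inord i |: T) l -> (l == i) || letter T l.
  by move=> lt_i; rewrite letterU1.
have fix0: ap (rho (deg k) 0) (4 * k + 8) = 4 * k + 8 by rewrite ap_rho0 ?ifF; lia.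
have eq8: 4 * k + 8 = 4 * k + 1 + 7 by lia.
have fix_y1: ap x (4 * k + 8) = 4 * k + 8.
  have [w /allP Jw ->] := span_word x1.
  elim: w Jw => [|l w IHw] Jw; first by rewrite /pw big_nil ap1; lia.
  rewrite pw_cons apM; set y := ap (rho _ l) _; suff ->: y = 4 * k + 8.
    by apply: IHw => z wz; apply: Jw; rewrite inE wz orbT.
  have Jl := Jw l (mem_head _ _); rewrite /y.
  case: l Jl {Jw y} (JT 1 l isT Jl) (letter_lt Jl) => [|[|[|[|l]]]] // _.
  - by rewrite eq8 ap_rho_right.
  - by rewrite (negPf T'2).
  by rewrite eq8 ap_rho_right.
have [||a [w [def_x aT /allP Jw]]] := @split_letter k _ T 0 x isT _ x2.
- move=> l Jl; apply: rho_commute => //; first exact: letter_lt Jl.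
  by case: l {Jl} (JT 2 l isT Jl) => [|[|l]] //=; rewrite (negPf T'1).
- by move/(JT 2 0 isT).
rewrite def_x groupM //.
have w23: all (mem [:: 2; 3]) w.
  apply/allP=> l /Jw/andP[Jl]; move: (JT 2 l isT Jl) (letter_lt Jl).
  by case: l {Jl} => [|[|[|[|l]]]] //=; rewrite (negPf T'1).
have fixw: ap (pw k w) (4 * k + 8) = 4 * k + 8.
  move: fix_y1; rewrite def_x apM rhoX //; case: odd; rewrite ?fix0 // ap1 //; lia.
have [T3|T'3] := boolP (letter T 3).
  have [b [e [lt_b lt_e def_w]]] := dihedral23_word k w23.
  rewrite def_w in fixw *; have b0 := word23_fix_y1 lt_b lt_e fixw.
  by rewrite mem_span_word // b0 /= all_nseq T3 orbT.
have w2: all (pred1 2) w.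
  apply/allP=> l wl; have /andP[Jl _] := Jw l wl; move/allP: w23 => /(_ l wl); rewrite !inE.
  by case/orP=> // /eqP l3; move: (JT 2 l isT Jl); rewrite l3 (negPf T'3).
move: fixw; have ->: pw k w = (rho (deg k) 2 ^+ size w)%g.
  elim: w w2 {Jw w23 def_x} => [|l w IHw] /=; first by rewrite /pw big_nil.
  by case/andP=> /eqP-> /IHw; rewrite pw_cons expgS => ->.
rewrite rhoX //; case: odd => //.
rewrite eq8 ap_rho_right // => /addnI; rewrite (_ : rmove 2 7 = 8) //.
Qed.

Lemma rho4_intersection k : intersection_property (@rho4 (deg k)).
Proof.
apply: intersection_of_pairs.
suff lt_pair (T : {set 'I_4}) i j : i < j < 4 -> ~~ letter T i -> ~~ letter T j ->
    span k (inord i |: T) :&: span k (inord j |: T) \subset span k T.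
  move=> T i j neq_ij Ti Tj.
  have lT (l : 'I_4) : letter T l = (l \in T) by rewrite /letter ltn_ord inord_val.
  case: (ltngtP i j) => [lt_ij|lt_ji|/val_inj eq_ij].
  - by have := lt_pair T i j; rewrite !lT lt_ij ltn_ord !inord_val => /(_ isT Ti Tj).
  - by have := lt_pair T j i; rewrite !lT lt_ji ltn_ord !inord_val setIC => /(_ isT Tj Ti).
  by rewrite eq_ij eqxx in neq_ij.
case/andP=> lt_ij lt_j4 T'i T'j; apply/subsetP=> x /setIP[xi xj].
have [i0|i_gt0] := posnP i.
  rewrite i0 in xi T'i; apply: (@meet_n123 k T j) => //; first by rewrite lt_j4 -i0 lt_ij.
  apply: span_sub xj => l; rewrite letterU1 // letter123 => /orP[/eqP->|Tl].
    by rewrite lt_j4 -i0 lt_ij.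
  by rewrite (letter_lt Tl) lt0n andbT; apply: contraNneq T'i => <-.
have [j3|ne_j3] := eqVneq j 3.
  rewrite j3 in xj T'j lt_ij; apply: (@meet_n012 k T i) => //.
  apply: span_sub xi => l; rewrite letterU1 ?letter012; last lia.
  case/orP=> [/eqP->//|Tl]; have := letter_lt Tl; rewrite ltnS leq_eqVlt => /orP[/eqP l3|//].
  by rewrite l3 (negPf T'j) in Tl.
have i1: i = 1 by lia.
have j2: j = 2 by lia.
by rewrite i1 j2 in xi xj T'i T'j; apply: meet_12.
Qed.

(** * Relations and orders of products of generators *)

Lemma rho_neq1 k j : j < 4 -> rho (deg k) j != 1%g.
Proof.
move=> lt_j; apply/eqP=> rho1; have [j0|j_gt0] := posnP j.
  by rewrite j0 in rho1; have := rho0_fix0 k; rewrite rho1 ap1.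
have [c lt_c neq_c]: exists2 c, c < 14 & rmove j c != c.
  by case: j lt_j j_gt0 {rho1} => [|[|[|[|j]]]] // _ _; [exists 0|exists 1|exists 4].
have := @ap_rho_right k j c j_gt0 lt_c; rewrite rho1 ap1; last lia.
by move/addnI/esym/eqP; rewrite (negPf neq_c).
Qed.

Lemma rho4_sggi k : is_sggi (@rho4 (deg k)).
Proof.
apply/andP; split.
  apply/forallP=> i; have lt_i := ltn_ord i.
  apply/eqP/prime_nt_dvdP; rewrite ?order_eq1 ?rho_neq1 //.
  by rewrite order_dvdn expgS expg1 /rho4 rho_sq.
apply/forallP=> i; apply/forallP=> j; apply/implyP=> far_ij.
rewrite expgMn; last by apply: rho_commute; rewrite ?ltn_ord // far_ij orbT.
by rewrite !expgS !expg0 !mulg1 /rho4 !rho_sq ?mulg1 ?ltn_ord.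
Qed.

(** The two 7-cycles give the factor 7; the left part gives the factor 2 once it contains an edge of
    label 1. *)
Lemma order_rho12 k : #[rho (deg k) 1 * rho (deg k) 2]%g = if k == 0 then 7 else 14.
Proof.
set c := (_ * _)%g; pose w j := flatten (nseq j [:: 1; 2]).
have pw_w j: pw k (w j) = (c ^+ j)%g by rewrite pw_nseq !pw_cons /pw big_nil mulg1.
have lt_w j: all (fun j => 0 < j < 4) (w j) by elim: j.
have c14: (c ^+ 14 = 1)%g.
  have := @eq_pw k (w 14) [::]; rewrite pw_w /pw big_nil; apply=> //; last by left.
  move=> d lt_d; apply/eqP; move: lt_d.
  by apply: (lt14P (P := fun d => rword (w 14) d == d)); vm_compute.
have c7: k = 0 -> (c ^+ 7 = 1)%g.
  move=> k0; have := @eq_pw k (w 7) [::]; rewrite pw_w /pw big_nil; apply=> //; last by right.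
  move=> d lt_d; apply/eqP; move: lt_d.
  by apply: (lt14P (P := fun d => rword (w 7) d == d)); vm_compute.
have c2: ~~ (#[c]%g %| 2).
  rewrite order_dvdn; apply/eqP=> c2; have := @ap_word_right k (w 2) 0 (lt_w 2) isT.
  rewrite pw_w c2 ap1; last lia.
  by move/addnI/esym/eqP; vm_compute.
have c7': k != 0 -> ~~ (#[c]%g %| 7).
  move=> k0; rewrite order_dvdn; apply/eqP=> c7'.
  have := @ap_word_left k (w 7) 1 isT; rewrite pw_w c7' ap1; last lia.
  have lt1: 1 < 4 * k + 1 by lia.
  by move=> /(_ lt1)/eqP; vm_compute.
have: #[c]%g \in divisors 14 by rewrite -dvdn_divisors // order_dvdn c14.
rewrite (_ : divisors 14 = [:: 1; 2; 7; 14]) // !inE; case: (eqVneq k 0) => [k0|/c7'].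
  have := c7 k0 => /eqP; rewrite -order_dvdn => H.
  by case/or4P=> /eqP E; rewrite E in c2 H *.
by move=> H; case/or4P=> /eqP E; rewrite E in c2 H *.
Qed.

Lemma order_rho23 k : #[rho (deg k) 2 * rho (deg k) 3]%g = 4.
Proof.
set c := (_ * _)%g.
have c2: ~~ (#[c]%g %| 2).
  rewrite order_dvdn; apply/eqP=> c2; have := @ap_word_right k (word23 2 0) 7 isT isT.
  rewrite pw_cat pw_nseq !pw_cons /pw !big_nil !mulg1 c2 ap1; last lia.
  by move/addnI/esym/eqP; vm_compute.
have: #[c]%g \in divisors 4 by rewrite -dvdn_divisors // order_dvdn rho23_order.
rewrite (_ : divisors 4 = [:: 1; 2; 4]) // !inE.
by case/or3P=> /eqP E; rewrite E in c2 *.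
Qed.

(** * Three-cycles *)

(** A 3-cycle for distinct a, b, c; trivial for b = c, but a transposition for c = a and b distinct
    from a. *)
Definition tri (T : finType) (G : {group {perm T}}) a b c :=
  (tperm a b * tperm a c)%g \in G.

Lemma tri_sym (T : finType) (G : {group {perm T}}) a b c : tri G a b c -> tri G a c b.
Proof. by rewrite /tri -groupV invMg !tpermV. Qed.

Lemma tri_rot (T : finType) (G : {group {perm T}}) a b c :
  c != a -> c != b -> tri G a b c -> tri G b c a.
Proof.
rewrite /tri => neq_ca neq_cb; rewrite (tpermC b a).
have ->: tperm b c = (tperm a c ^ tperm a b)%g by rewrite tpermJ tpermL tpermD // eq_sym.
by rewrite /conjg tpermV -!mulgA tperm2 mulg1.
Qed.

Lemma tri_trans (T : finType) (G : {group {perm T}}) a b c d :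
  tri G a b c -> tri G a b d -> tri G a c d.
Proof.
move=> /tri_sym Gcb Gbd; have := groupM Gcb Gbd.
by rewrite mulgA -(mulgA (tperm a c)) tperm2 mulg1.
Qed.

Lemma tri_conj (T : finType) (G : {group {perm T}}) g a b c :
  g \in G -> tri G a b c -> tri G (g a) (g b) (g c).
Proof. by move=> Gg; rewrite /tri -(groupJr _ Gg) conjMg !tpermJ. Qed.

(** Permutations are products of transpositions (a y), each congruent to (a b) modulo these
    3-cycles, so s or (a b) s lies in G; parity excludes the latter alone. *)
Lemma Alt_of_tri (T : finType) (G : {group {perm T}}) a b :
  a != b -> G \subset ('Alt_T)%g -> (forall c, c != a -> tri G a b c) -> G :=: ('Alt_T)%g.
Proof.
move=> neq_ab sGA Gtri; apply/eqP; rewrite eqEsubset sGA; apply/subsetP=> s.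
rewrite Alt_even => even_s.
have: s \in <<[set tperm a y | y in T]>>%g by rewrite gen_tperm inE.
case/gen_prodgP=> n [c Tc def_s].
have: (s \in G) || ((tperm a b * s)%g \in G).
  rewrite {even_s}def_s; elim/big_rec: _ => [|i x _ IHx]; first by rewrite group1.
  have /imsetP[y _ ->] := Tc i; have [->|neq_ya] := eqVneq y a.
    by rewrite tperm1 mul1g.
  have Gby := Gtri y neq_ya; case/orP: IHx => [Gx|Gx].
    by apply/orP; right; rewrite mulgA groupM.
  apply/orP; left; rewrite -[x](mulKg (tperm a b)) tpermV mulgA (groupM _ Gx) //.
  exact: tri_sym Gby.
by case/orP=> // /(subsetP sGA); rewrite Alt_even odd_permM (negPf even_s) addbF odd_tperm neq_ab.
Qed.

(** * Parity of the generators *)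

Lemma odd_prod_transp k j s :
    all (fun e : nat * nat * seq nat => [&& e.1.1 < deg k, e.1.2 < deg k & e.1.1 != e.1.2]) s ->
  odd_perm (\prod_(e <- s | j \in e.2) transp (deg k) e.1.1 e.1.2)%g
    = odd (count (fun e => j \in e.2) s).
Proof.
elim: s => [|e s IHs] /=; first by rewrite big_nil odd_perm1.
case/andP=> /and3P[lt1 lt2 neq12] /IHs; rewrite big_cons; case: (j \in e.2) => // IH.
rewrite odd_permM IH transpE // odd_tperm oddD; congr (_ (+) _).
by rewrite -val_eqE /= !inordK // neq12.
Qed.

Lemma count_chain j K : count (fun e : nat * nat * seq nat => j \in e.2) (chain K.*2) =
  if j < 2 then K else 0.
Proof.
elim: K => [|K IHK]; first by case: ifP.
rewrite chain_step count_cat IHK /= !inE; case: j {IHK} => [|[|j]] //=; lia.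
Qed.

(** The labels 0, 1, 2, 3 occur on 2k + 2, 2k + 6, 6 and 2 edges; the residue of n modulo 4 makes
    the first two even. *)
Lemma even_rho k j : j < 4 -> ~~ odd_perm (rho (deg k) j).
Proof.
move=> lt_j; rewrite /rho odd_prod_transp graph_edges_deg tail_edgesE.
  rewrite count_cat count_chain /shift count_map.
  case: j lt_j => [|[|[|[|j]]]] //= _; lia.
rewrite all_cat; apply/andP; split; last by rewrite /=; lia.
apply/allP=> e /mapP[s]; rewrite mem_iota => Hs -> /=; rewrite /vx; lia.
Qed.

Lemma Ggraph_Alt k : Ggraph (deg k) \subset ('Alt_('I_(deg k)))%g.
Proof.
rewrite gen_subG; apply/subsetP=> _ /imsetP[i _ ->].
by rewrite Alt_even even_rho.
Qed.

Lemma rho_Ggraph k j : j < 4 -> rho (deg k) j \in Ggraph (deg k).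
Proof. by move=> lt_j; apply: mem_gen; apply/imsetP; exists (inord j); rewrite // /rho4 inordK. Qed.

Lemma pw_Ggraph k w : all (fun j => j < 4) w -> pw k w \in Ggraph (deg k).
Proof.
move/allP=> lt_w; rewrite /pw big_seq; apply: group_prod => j /lt_w lt_j.
exact: rho_Ggraph.
Qed.

(** * Three-cycles contained in G *)

Definition tri_at k a b c :=
  tri (Ggraph (deg k)) (inord a : 'I_(deg k)) (inord b) (inord c).

Lemma tri_at_conj k g a b c : g \in Ggraph (deg k) -> tri_at k a b c ->
  tri_at k (ap g a) (ap g b) (ap g c).
Proof. by move=> Gg /(tri_conj Gg); rewrite /tri_at /ap !inord_val. Qed.

(* This word swaps x_(n-13) and y_7, swaps x_(n-12) and x_(n-11), and fixes x_1, .., x_(n-14): it commutes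
   with rho_0 except for the edge {x_(n-14), x_(n-13)}. *)
Definition wtri := [:: 1; 2; 1; 2; 1; 2; 1; 3; 2; 1; 2; 3; 2; 1; 3; 2; 1; 3; 2; 1].

Lemma tri_base k : tri_at k (4 * k) (4 * k + 1) (4 * k + 1 + 13).
Proof.
set g := pw k wtri.
pose z : {perm 'I_(deg k)} :=
  (tperm (inord (4 * k)) (inord (4 * k + 1)) * tperm (inord (4 * k)) (inord (4 * k + 1 + 13)))%g.
have Gr := rho_Ggraph k (isT : 0 < 4).
have Gg : g \in Ggraph (deg k) by exact: pw_Ggraph.
suff def_z: (rho (deg k) 0 * g * rho (deg k) 0 = z * g)%g.
  by rewrite /tri_at /tri -[(_ * _)%g]/z -(groupMr _ Gg) -def_z !groupM.
have g_left i : i < 4 * k + 1 -> ap g i = i by move=> lt_i; rewrite ap_word_left.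
have g_right c : c < 14 -> ap g (4 * k + 1 + c) = 4 * k + 1 + rword wtri c.
  by move=> lt_c; rewrite ap_word_right.
have g13: ap g (4 * k + 1 + 13) = 4 * k + 1 + 0.
  by rewrite g_right //; congr addn; vm_compute.
have g0: ap g (4 * k + 1 + 0) = 4 * k + 1 + 13.
  by rewrite g_right //; congr addn; vm_compute.
have z_ap i : i < deg k ->
    ap z i = swapn (4 * k) (4 * k + 1 + 13) (swapn (4 * k) (4 * k + 1) i).
  move=> lt_i; have lt_s: swapn (4 * k) (4 * k + 1) i < deg k by apply: swapn_lt => //; lia.
  by rewrite apM !ap_tperm //; lia.
move: z z_ap => z z_ap; apply: eq_ap => i lt_i; rewrite !apM z_ap //.
have [lt_im|le_mi] := ltnP i (4 * k).
  have ->: swapn (4 * k) (4 * k + 1 + 13) (swapn (4 * k) (4 * k + 1) i) = i.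
    by rewrite /swapn; repeat case: ifP; lia.
  have r_lt: ap (rho (deg k) 0) i < 4 * k by rewrite ap_rho0; repeat case: ifP; lia.
  rewrite !g_left; try lia.
  by rewrite -apM rho_sq // ap1.
have [->|neq_i] := eqVneq i (4 * k).
  have ->: swapn (4 * k) (4 * k + 1 + 13) (swapn (4 * k) (4 * k + 1) (4 * k)) = 4 * k + 1 + 0.
    by rewrite /swapn; repeat case: ifP; lia.
  have ->: ap (rho (deg k) 0) (4 * k) = 4 * k + 1 + 0 by rewrite ap_rho0; repeat case: ifP; lia.
  rewrite g0.
  by rewrite ap_rho0; repeat case: ifP; lia.
have [c def_i lt_c]: exists2 c, i = 4 * k + 1 + c & c < 14 by exists (i - (4 * k + 1)); lia.
rewrite def_i in lt_i neq_i le_mi *; have [c0|c_gt0] := posnP c.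
  have ->: swapn (4 * k) (4 * k + 1 + 13) (swapn (4 * k) (4 * k + 1) (4 * k + 1 + c))
      = 4 * k + 1 + 13 by rewrite /swapn; repeat case: ifP; lia.
  have ->: ap (rho (deg k) 0) (4 * k + 1 + c) = 4 * k by rewrite ap_rho0; repeat case: ifP; lia.
  rewrite g13 g_left; last lia.
  by rewrite ap_rho0; repeat case: ifP; lia.
rewrite ap_rho0_right ?c_gt0 //.
have lt_s: swapn 1 2 c < 14 by rewrite /swapn; repeat case: ifP.
have [c13|neq_c] := eqVneq c 13.
  have ->: swapn (4 * k) (4 * k + 1 + 13) (swapn (4 * k) (4 * k + 1) (4 * k + 1 + c))
      = 4 * k by rewrite /swapn; repeat case: ifP; lia.
  rewrite c13 (_ : swapn 1 2 13 = 13) // g13 g_left; last lia.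
  by rewrite ap_rho0; repeat case: ifP; lia.
have ->: swapn (4 * k) (4 * k + 1 + 13) (swapn (4 * k) (4 * k + 1) (4 * k + 1 + c))
    = 4 * k + 1 + c by rewrite /swapn; repeat case: ifP; lia.
rewrite !g_right //.
(* On the offsets other than 0 and 13, g commutes with the swap of offsets 1 and 2. *)
have: (0 < rword wtri (swapn 1 2 c) < 14) && (swapn 1 2 (rword wtri (swapn 1 2 c)) == rword wtri c).
  move: neq_c; apply/implyP; move: c_gt0; apply/implyP; move: lt_c.
  apply: (lt14P (P := fun c => (0 < c) ==> (c != 13) ==>
     (0 < rword wtri (swapn 1 2 c) < 14)
     && (swapn 1 2 (rword wtri (swapn 1 2 c)) == rword wtri c))); by vm_compute.
by case/andP=> lt_r /eqP <-; rewrite ap_rho0_right.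
Qed.

(* Words moving the pair {x_(n-13), y_7} onto that of the vertex [u]; they contain rho_1 an even number of
   times, so that they fix x_(n-14). *)
Definition wpair (u : nat) : seq nat := nth [::]
  [:: [::]; [:: 1; 2; 1; 2; 1; 3; 2; 1; 2]; [:: 1; 2; 1; 2; 1; 3; 2; 1]; [:: 1; 2; 1];
      [:: 1; 2; 1; 2]; [:: 1; 2; 1; 2; 3]; [:: 1; 2; 1; 2; 3; 2]] (minn u (13 - u)).

Lemma inord_neq k a b : a < deg k -> b < deg k -> a != b -> (inord a : 'I_(deg k)) != inord b.
Proof. by move=> lt_a lt_b neq; rewrite -val_eqE /= !inordK. Qed.

Lemma tri_at_rot k a b c : a < deg k -> b < deg k -> c < deg k ->
  c != a -> c != b -> tri_at k a b c -> tri_at k b c a.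
Proof. by move=> *; apply: tri_rot => //; apply: inord_neq. Qed.

Lemma tri_pair k u : u < 14 -> tri_at k (4 * k) (4 * k + 1 + u) (4 * k + 1 + (13 - u)).
Proof.
move=> lt_u; have: [&& all (fun j => 0 < j < 4) (wpair u), ~~ odd (count_mem 1 (wpair u)) &
    ((rword (wpair u) 0, rword (wpair u) 13) == (u, 13 - u))
    || ((rword (wpair u) 0, rword (wpair u) 13) == (13 - u, u))].
  move: lt_u; apply: (lt14P (P := fun u => [&& all (fun j => 0 < j < 4) (wpair u),
   ~~ odd (count_mem 1 (wpair u)) & ((rword (wpair u) 0, rword (wpair u) 13) == (u, 13 - u))
    || ((rword (wpair u) 0, rword (wpair u) 13) == (13 - u, u))])); by vm_compute.
case/and3P=> lt_w even_w maps_w.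
have Gw: pw k (wpair u) \in Ggraph (deg k).
  by apply: pw_Ggraph; apply: sub_all lt_w => j /andP[].
have := tri_base k; rewrite -[in X in tri_at _ _ X _](addn0 (4 * k + 1)) => /(tri_at_conj Gw).
rewrite [X in tri_at k X _ _]ap_word_left; first last.
- by rewrite addn1.
- by apply: sub_all lt_w => j /andP[].
rewrite (negPf even_w) !ap_word_right //.
by case/orP: maps_w => /eqP[-> ->] // /tri_sym.
Qed.

Lemma tri_right k i : 4 * k <= i < deg k -> i != 4 * k + 1 + 13 ->
  tri_at k (4 * k + 1 + 13) (4 * k + 1 + 12) i.
Proof.
move=> lt_i neq_i.
have tri0 : tri_at k (4 * k) (4 * k + 1 + 13) (4 * k + 1 + 0) by exact: (@tri_pair k 13).
have tri_d d : 0 < d < 13 -> tri_at k (4 * k + 1 + 13) (4 * k + 1 + 0) (4 * k + 1 + d).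
  move=> lt_d; have lt_d14: d < 14 by lia.
  apply: tri_at_rot; try lia.
  (* The 3-cycle of the pair of d sends x_(n-14) to offset d and fixes x_(n-13) and y_7. *)
  have := tri_at_conj (tri_pair k lt_d14) tri0.
  rewrite !apM !ap_tperm; try lia; try (apply: swapn_lt; lia).
  by congr tri_at; rewrite /swapn; repeat case: ifP; lia.
have tri12 := tri_d 12 isT.
have [->|neq4k] := eqVneq i (4 * k).
  by apply: tri_trans tri12 _; apply: tri_at_rot tri0; lia.
have [->|neq_m] := eqVneq i (4 * k + 1 + 0); first exact: tri_sym tri12.
have ->: i = 4 * k + 1 + (i - (4 * k + 1)) by lia.
apply: tri_trans tri12 _; apply: tri_d; lia.
Qed.

Lemma tri_all k i : i < deg k -> i != 4 * k + 1 + 13 ->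
  tri_at k (4 * k + 1 + 13) (4 * k + 1 + 12) i.
Proof.
move=> lt_i neq_i; have [le_i|gt_i] := leqP (4 * k) i; first by rewrite tri_right ?le_i.
have ->: i = 4 * k - (4 * k - i) by lia.
elim: (4 * k - i) => [|j IHj]; first by rewrite subn0; apply: tri_right; lia.
(* Past the end of the path the truncated subtraction stays at 0. *)
have [le_j|lt_j] := leqP (4 * k) j.
  by rewrite (_ : 4 * k - j.+1 = 4 * k - j) //; lia.
have [odd_j|ev_j] := boolP (odd (4 * k - j)).
  have := tri_at_conj (rho_Ggraph k (isT : 0 < 4)) IHj; rewrite !ap_rho0; try lia.
  by congr tri_at; repeat case: ifP; lia.
(* Unlike rho_0, rho_1 also swaps y_6 and y_7, so the 3-cycle is reordered afterwards. *)
have := tri_at_conj (rho_Ggraph k (isT : 1 < 4)) IHj; rewrite !ap_rho_right //.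
rewrite ap_rho_left //; last lia.
rewrite (_ : rmove 1 13 = 12) // (_ : rmove 1 12 = 13) // (_ : lmove 1 _ = 4 * k - j.+1).
  by move=> H; apply: tri_sym; apply: tri_at_rot H; lia.
by rewrite /lmove; repeat case: ifP; lia.
Qed.

Lemma GgraphE k : Ggraph (deg k) :=: ('Alt_('I_(deg k)))%g.
Proof.
apply: (@Alt_of_tri _ _ (inord (4 * k + 1 + 13)) (inord (4 * k + 1 + 12))).
- by apply: inord_neq; lia.
- exact: Ggraph_Alt.
move=> c neq_c; rewrite -(inord_val c); apply: tri_all; first exact: ltn_ord.
by apply: contraNneq neq_c => <-; rewrite inord_val.
Qed.

Local Open Scope group_scope.

Theorem theorem4p11 (n : nat) :
  (15 <= n)%N -> n = 3 %[mod 4] ->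
  Ggraph n \isog 'Alt_('I_n) /\
  string_C_group (rho4 n) /\
  [:: #[rho n 0 * rho n 1]; #[rho n 1 * rho n 2]; #[rho n 2 * rho n 3]]%g
    = (if n == 15 then [:: 10; 7; 4] else [:: 2 * (n - 10); 14; 4])%N.
Proof.
move=> le15n n3.
have [k ->]: exists k, n = (4 * k + 14).+1 by exists ((n - 15) %/ 4)%N; lia.
split; first by rewrite GgraphE isog_refl.
split; first by split; [apply: rho4_sggi | apply: rho4_intersection].
rewrite order_rot01 order_rho12 order_rho23.
have [->|k_neq0] := eqVneq k 0%N; first by [].
rewrite ifF; last lia.
by congr [:: _; _; _]; lia.
Qed.
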